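(* Let $H$ be a Hopf algebra over a field $k$ whose characteristic is not $2$. Then: (a) Suppose $\alpha \in \mathrm{G}(H^o)$ and $y \in \mathrm{G}(H)$ satisfy $\alpha(y) = -1$ and $\alpha \rightharpoonup h \leftharpoonup \alpha^{-1} = yhy^{-1}$ for all $h \in H$. Then $B_{\alpha, y}$ is a Hopf algebra in ${}_H^H\mathcal{YD}$. (b) Let $B$ be a $2$-dimensional Hopf algebra in ${}_H^H\mathcal{YD}$. Then $B \simeq k[\mathbb{Z}_2]$ with its $k$-Hopf algebra structure and trivial $H$-module and $H$-comodule structures, or $B \simeq B_{\alpha, y}$, where $\alpha \in \mathrm{G}(H^o)$ and $y \in \mathrm{G}(H)$ satisfy $\alpha(y) = -1$ and $\alpha \rightharpoonup h \leftharpoonup \alpha^{-1} = yhy^{-1}$ for all $h \in H$.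
   Context: $\mathrm{G}(C)$ denotes the set of grouplike elements of a coalgebra $C$; $H^o$ is the finite dual, so $\mathrm{G}(H^o) = \mathrm{Alg}_k(H,k)$, and $\alpha^{-1}$ is the convolution inverse. For $\alpha \in H^*$, $h \in H$: $\alpha \rightharpoonup h = h_{(1)}\alpha(h_{(2)})$ and $h \leftharpoonup \alpha = \alpha(h_{(1)})h_{(2)}$. ${}_H^H\mathcal{YD}$ is the category of left-left Yetter–Drinfel'd modules: triples $(M,\cdot,\rho)$ with $M$ a left $H$-module and left $H$-comodule, $\rho(m) = m_{(-1)} \otimes m_{(0)}$, such that $h_{(1)}m_{(-1)} \otimes h_{(2)}\cdot m_{(0)} = (h_{(1)}\cdot m)_{(-1)}h_{(2)} \otimes (h_{(1)}\cdot m)_{(0)}$ for all $h \in H$, $m \in M$. Morphisms are maps which are $H$-linear and $H$-colinear. A bialgebra of ${}_H^H\mathcal{YD}$ is an object $B$ which is a $k$-algebra and a $k$-coalgebra all of whose structure maps are morphisms (i.e. $B$ is a left $H$-module algebra, $H$-comodule algebra, $H$-module coalgebra and $H$-comodule coalgebra), such that $\epsilon$ is an algebra map, $\Delta(1)=1\otimes 1$, and $\Delta(bb') = b_{(1)}(b_{(2)(-1)}\cdot b'_{(1)}) \otimes b_{(2)(0)}b'_{(2)}$. It is a Hopf algebra of ${}_H^H\mathcal{YD}$ if there is a morphism $S : B \to B$ with $S(b_{(1)})b_{(2)} = \epsilon(b)1 = b_{(1)}S(b_{(2)})$ for all $b \in B$. Isomorphisms $\simeq$ are of Hopf algebras of ${}_H^H\mathcal{YD}$.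 Trivial $H$-module structure: $h\cdot m = \epsilon(h)m$; trivial $H$-comodule structure: $\rho(m) = 1 \otimes m$. For $\alpha \in \mathrm{G}(H^o)$ and $y \in \mathrm{G}(H)$, $B_{\alpha,y}$ is the $k$-algebra with basis $\{1,n\}$ where $1$ is the identity and $n^2 = 0$, with coalgebra structure determined by $\Delta(1) = 1 \otimes 1$, $\Delta(n) = n \otimes 1 + 1 \otimes n$ (so $\epsilon(1)=1$, $\epsilon(n)=0$), left $H$-module structure $h\cdot 1 = \epsilon(h)1$, $h\cdot n = \alpha(h)n$, and left $H$-comodule structure $\rho(1) = 1 \otimes 1$, $\rho(n) = y \otimes n$. *)

(* Defs.v *)
From HB Require Import structures.
From mathcomp Require Import all_boot all_algebra.
From mathcomp Require Import boolp.

Set Implicit Arguments.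
Unset Strict Implicit.
Unset Printing Implicit Defensive.

Import GRing.Theory.
Local Open Scope ring_scope.
Local Open Scope quotient_scope.

(* A formal sum [:: (u1, v1); ...; (un, vn)] stands for the tensor
   u1 (x) v1 + ... + un (x) vn; tens_eq is the congruence generated by
   commutativity of the sum and bilinearity. *)
Inductive tens_eq (k : fieldType) (U V : lmodType k) :
    seq (U * V) -> seq (U * V) -> Prop :=
| TensRefl s : tens_eq s s
| TensSym s t : tens_eq s t -> tens_eq t s
| TensTrans s t r : tens_eq s t -> tens_eq t r -> tens_eq s r
| TensCat s s' t t' :
    tens_eq s s' -> tens_eq t t' -> tens_eq (s ++ t) (s' ++ t')
| TensC s t : tens_eq (s ++ t) (t ++ s)
| Tens0l v : tens_eq [:: (0, v)] [::]
| Tens0r u : tens_eq [:: (u, 0)] [::]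
| TensDl u u' v : tens_eq [:: (u + u', v)] [:: (u, v); (u', v)]
| TensDr u v v' : tens_eq [:: (u, v + v')] [:: (u, v); (u, v')]
| TensZ a u v : tens_eq [:: (a *: u, v)] [:: (u, a *: v)].

Section Tensor.
Variables (k : fieldType) (U V : lmodType k).

Definition tens_eqb (s t : seq (U * V)) : bool := `[< tens_eq s t >].

Lemma tens_eqb_refl : reflexive tens_eqb.
Proof. by move=> s; apply/asboolP; apply: TensRefl. Qed.

Lemma tens_eqb_sym : symmetric tens_eqb.
Proof.
by move=> s t; apply/asboolP/asboolP => h; apply: TensSym.
Qed.

Lemma tens_eqb_trans : transitive tens_eqb.
Proof.
move=> s t r /asboolP h1 /asboolP h2; apply/asboolP.
exact: TensTrans h1 h2.
Qed.

Canonical tens_equiv :=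
  EquivRel tens_eqb tens_eqb_refl tens_eqb_sym tens_eqb_trans.

Definition tensor := {eq_quot tens_eqb}.
HB.instance Definition _ := Choice.on tensor.

Definition tens_of (s : seq (U * V)) : tensor := \pi_{eq_quot tens_eqb} s.

Lemma tens_ofP s t : tens_of s = tens_of t <-> tens_eq s t.
Proof.
split=> [/eqP|h]; first by rewrite /tens_of eqmodE => /asboolP.
by apply/eqP; rewrite /tens_of eqmodE; apply/asboolP.
Qed.

Lemma tens_ofK (t : tensor) : tens_of (repr t) = t.
Proof. by rewrite /tens_of reprK. Qed.

Lemma tens_repr s : tens_eq (repr (tens_of s)) s.
Proof. by apply/tens_ofP; rewrite tens_ofK. Qed.

Let scl (a : k) (s : seq (U * V)) := [seq (a *: p.1, p.2) | p <- s].

Let scl_eq a s t : tens_eq s t -> tens_eq (scl a s) (scl a t).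
Proof.
elim=> {s t}.
- by move=> s; apply: TensRefl.
- by move=> s t _; apply: TensSym.
- by move=> s t r _ h1 _; apply: TensTrans.
- by move=> s s' t t' _ h1 _ h2; rewrite /scl !map_cat; apply: TensCat.
- by move=> s t; rewrite /scl !map_cat; apply: TensC.
- by move=> v; rewrite /scl /= scaler0; apply: Tens0l.
- by move=> u; apply: Tens0r.
- by move=> u u' v; rewrite /scl /= scalerDr; apply: TensDl.
- by move=> u v v'; apply: TensDr.
- move=> b u v; rewrite /scl /= scalerA mulrC -scalerA; exact: TensZ.
Qed.

Definition tens0 : tensor := tens_of [::].
Definition tens_add (x y : tensor) : tensor := tens_of (repr x ++ repr y).
Definition tens_scale (a : k) (x : tensor) : tensor := tens_of (scl a (repr x)).
Definition tens_opp (x : tensor) : tensor := tens_scale (-1) x.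

Lemma tens_addE s t : tens_add (tens_of s) (tens_of t) = tens_of (s ++ t).
Proof. by apply/tens_ofP; apply: TensCat; apply: tens_repr. Qed.

Let tens_scaleE a s : tens_scale a (tens_of s) = tens_of (scl a s).
Proof. by apply/tens_ofP; apply: scl_eq; apply: tens_repr. Qed.

Let tensE (x : tensor) : exists s, x = tens_of s.
Proof. by exists (repr x); rewrite tens_ofK. Qed.

Let tens_addA : associative tens_add.
Proof.
move=> x y z; have [s ->] := tensE x; have [t ->] := tensE y.
by have [r ->] := tensE z; rewrite !tens_addE catA.
Qed.

Let tens_addC : commutative tens_add.
Proof.
move=> x y; have [s ->] := tensE x; have [t ->] := tensE y.
by rewrite !tens_addE; apply/tens_ofP; apply: TensC.
Qed.

Let tens_add0 : left_id tens0 tens_add.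
Proof. by move=> x; have [s ->] := tensE x; rewrite /tens0 tens_addE. Qed.

Let tens_scaleDl x a b :
  tens_scale (a + b) x = tens_add (tens_scale a x) (tens_scale b x).
Proof.
have [s ->] := tensE x; rewrite !tens_scaleE tens_addE; apply/tens_ofP.
elim: s => [|[u v] s ih]; first exact: TensRefl.
rewrite /scl /= -[(a *: u, v) :: _]cat1s -[_ :: map _ s]cat1s.
apply: (@TensTrans _ _ _ _ ([:: (a *: u, v); (b *: u, v)] ++ (scl a s ++ scl b s))).
  by apply: TensCat; rewrite //= scalerDl; apply: TensDl.
rewrite -[[:: _; _]]/([:: (a *: u, v)] ++ [:: (b *: u, v)]) -!catA.
apply: TensCat; first exact: TensRefl.
rewrite -[_ :: map _ s]cat1s !catA; apply: TensCat; last exact: TensRefl.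
exact: TensC.
Qed.

Let tens_scale0 x : tens_scale 0 x = tens0.
Proof.
have [s ->] := tensE x; rewrite tens_scaleE; apply/tens_ofP.
elim: s => [|[u v] s ih]; first exact: TensRefl.
rewrite /scl /= scale0r -cat1s -[[::]]/([::] ++ [::]).
by apply: TensCat => //; apply: Tens0l.
Qed.

Let tens_scale1 : left_id 1 tens_scale.
Proof.
move=> x; have [s ->] := tensE x; rewrite tens_scaleE; congr tens_of.
by rewrite -[RHS]map_id; apply: eq_map => -[u v]; rewrite scale1r.
Qed.

Let tens_addN : left_inverse tens0 tens_opp tens_add.
Proof.
move=> x; rewrite -{2}[x]tens_scale1 /tens_opp -tens_scaleDl.
by rewrite addNr tens_scale0.
Qed.

HB.instance Definition _ :=
  GRing.isZmodule.Build tensor tens_addA tens_addC tens_add0 tens_addN.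

Let tens_scaleA a b x : tens_scale a (tens_scale b x) = tens_scale (a * b) x.
Proof.
have [s ->] := tensE x; rewrite !tens_scaleE; congr tens_of.
by rewrite /scl -map_comp; apply: eq_map => p /=; rewrite scalerA.
Qed.

Let tens_scaleDr : right_distributive tens_scale +%R.
Proof.
move=> a x y; have [s ->] := tensE x; have [t ->] := tensE y.
rewrite -[_ + _]/(tens_add _ _) tens_addE !tens_scaleE.
by rewrite -[_ + _]/(tens_add _ _) tens_addE /scl map_cat.
Qed.

HB.instance Definition _ := GRing.Zmodule_isLmodule.Build k tensor
  tens_scaleA tens_scale1 tens_scaleDr (fun x a b => tens_scaleDl x a b).

Definition tprod (u : U) (v : V) : tensor := tens_of [:: (u, v)].

Lemma tprodDl u u' v : tprod (u + u') v = tprod u v + tprod u' v.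
Proof.
rewrite -[RHS]/(tens_add _ _) tens_addE; apply/tens_ofP; exact: TensDl.
Qed.

Lemma tprodDr u v v' : tprod u (v + v') = tprod u v + tprod u v'.
Proof.
rewrite -[RHS]/(tens_add _ _) tens_addE; apply/tens_ofP; exact: TensDr.
Qed.

Lemma tprodZl a u v : tprod (a *: u) v = a *: tprod u v.
Proof. by rewrite -[RHS]/(tens_scale _ _) tens_scaleE. Qed.

Lemma tprodZr a u v : tprod u (a *: v) = a *: tprod u v.
Proof. by rewrite -tprodZl; apply/tens_ofP; apply: TensSym; apply: TensZ. Qed.

Lemma tens_ofE s : tens_of s = \sum_(p <- s) tprod p.1 p.2.
Proof.
elim: s => [|[u v] s ih]; first by rewrite big_nil.
by rewrite big_cons -ih -[RHS]/(tens_add _ _) tens_addE.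
Qed.

Lemma tensor_sum (x : tensor) : x = \sum_(p <- repr x) tprod p.1 p.2.
Proof. by rewrite -tens_ofE tens_ofK. Qed.

(* The value at x of the linear map U (x) V -> W induced by f : U -> V -> W.
   It depends on the chosen representative of x unless f is bilinear; in all
   uses below f is bilinear once the structure maps involved are linear. *)
Definition tlift (W : zmodType) (f : U -> V -> W) (x : tensor) : W :=
  \sum_(p <- repr x) f p.1 p.2.

Section Universal.
Variables (W : lmodType k) (f : U -> V -> W).
Hypotheses (fl : forall v, linear (f^~ v)) (fr : forall u, linear (f u)).

Let f0l v : f 0 v = 0.
Proof. by have := fl v (-1) 0 0; rewrite scaler0 addr0 scaleN1r addNr. Qed.
Let f0r u : f u 0 = 0.
Proof. by have := fr u (-1) 0 0; rewrite scaler0 addr0 scaleN1r addNr. Qed.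

Lemma tlift_of s : tlift f (tens_of s) = \sum_(p <- s) f p.1 p.2.
Proof.
rewrite /tlift; have : tens_eq (repr (tens_of s)) s by apply: tens_repr.
move: (repr _) => t; elim=> {s t} //=.
- by move=> ? ? ? _ -> _ ->.
- by move=> ? ? ? ? _ h1 _ h2; rewrite !big_cat /= h1 h2.
- by move=> ? ?; rewrite !big_cat /= addrC.
- by move=> v; rewrite big_seq1 big_nil f0l.
- by move=> u; rewrite big_seq1 big_nil f0r.
- move=> u u' v; rewrite !big_cons !big_nil !addr0 /=.
  by have := fl v 1 u u'; rewrite !scale1r.
- move=> u v v'; rewrite !big_cons !big_nil !addr0 /=.
  by have := fr u 1 v v'; rewrite !scale1r.
- move=> a u v; rewrite !big_seq1 /=.
  have := fl v a u 0; rewrite addr0 f0l addr0 => ->.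
  by have := fr u a v 0; rewrite addr0 f0r addr0 => ->.
Qed.

Lemma tlift_tprod u v : tlift f (tprod u v) = f u v.
Proof. by rewrite tlift_of big_seq1. Qed.

Lemma tlift_linear : linear (tlift f).
Proof.
move=> a x y; have [s ->] := tensE x; have [t ->] := tensE y.
rewrite -[_ *: _]/(tens_scale _ _) tens_scaleE -[_ + _]/(tens_add _ _) tens_addE.
rewrite !tlift_of big_cat big_map scaler_sumr /=; congr (_ + _).
apply: eq_bigr => p _.
by have := fl p.2 a p.1 0; rewrite addr0 f0l addr0.
Qed.

Lemma tlift_unique (g : tensor -> W) : linear g ->
  (forall u v, g (tprod u v) = f u v) -> g =1 tlift f.
Proof.
move=> gl gE x; rewrite {1}(tensor_sum x) /tlift.
have g0 : g 0 = 0 by have := gl (-1) 0 0; rewrite scaler0 addr0 scaleN1r addNr.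
have gD a b : g (a + b) = g a + g b by have := gl 1 a b; rewrite !scale1r.
elim: (repr x) => [|p s ih]; first by rewrite !big_nil.
by rewrite !big_cons gD gE ih.
Qed.

End Universal.
End Tensor.

Arguments tprod {k U V}.

Notation "{ 'tensor' U & V }" := (tensor U V)
  (at level 0, U at level 98, V at level 98,
   format "{ 'tensor'  U  &  V }") : type_scope.
Notation "u \ox v" := (tprod u v) (at level 38, left associativity) : ring_scope.

(* Sweedler notation: if t is the sum of the a (x) b, the sum of the F(a, b). *)
Notation "\sw_ ( a , b <- t ) F" := (tlift (fun a b => F) t)
  (at level 41, a name, b name, F at level 41, t at level 100,
   format "\sw_ ( a ,  b  <-  t )  F") : ring_scope.

Record is_coalgebra (k : fieldType) (C : lmodType k)
    (delta : C -> {tensor C & C}) (eps : C -> k^o) : Prop := IsCoalgebra {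
  coalg_comul_linear : linear delta;
  coalg_counit_linear : linear eps;
  coalg_coassoc : forall c,
    \sw_(a, b <- delta c) \sw_(a1, a2 <- delta a) a1 \ox (a2 \ox b) =
    \sw_(a, b <- delta c) a \ox delta b;
  coalg_counitl : forall c, \sw_(a, b <- delta c) eps a *: b = c;
  coalg_counitr : forall c, \sw_(a, b <- delta c) eps b *: a = c
}.

HB.mixin Record Algebra_isHopf (k : fieldType) H of GRing.Algebra k H := {
  comul : H -> {tensor H & H};
  counit : H -> k^o;
  antipode : H -> H;
  hopf_coalgebra : is_coalgebra comul counit;
  comul1 : comul 1 = 1 \ox 1;
  comulM : forall g h : H, comul (g * h) =
    \sw_(g1, g2 <- comul g) \sw_(h1, h2 <- comul h) (g1 * h1) \ox (g2 * h2);
  counit1 : counit 1 = 1;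
  counitM : forall g h : H, counit (g * h) = counit g * counit h;
  antipode_linear : linear antipode;
  antipodel : forall h : H,
    \sw_(h1, h2 <- comul h) antipode h1 * h2 = counit h *: 1;
  antipoder : forall h : H,
    \sw_(h1, h2 <- comul h) h1 * antipode h2 = counit h *: 1
}.

#[short(type="hopfAlgType")]
HB.structure Definition HopfAlgebra (k : fieldType) :=
  {H of Algebra_isHopf k H & GRing.Algebra k H}.

Definition grouplike (k : fieldType) (H : hopfAlgType k) (y : H) : Prop :=
  comul y = y \ox y /\ counit y = 1.

Section Functionals.
Variables (k : fieldType) (H : hopfAlgType k).
Implicit Types (f g : H -> k^o) (h y : H).

Definition conv f g : H -> k^o := fun h => \sw_(h1, h2 <- comul h) f h1 * g h2.

(* f -> h (left hit action) and h <- f (right hit action). *)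
Definition lhit f h : H := \sw_(h1, h2 <- comul h) f h2 *: h1.
Definition rhit h f : H := \sw_(h1, h2 <- comul h) f h1 *: h2.

(* G(H^o) = Alg_k(H, k) is the type {lrmorphism H -> k^o}. Inverses in the
   groups Alg_k(H, k) (for convolution) and G(H) are given by the antipode; see
   the four lemmas below. *)
Definition dual_inv f : H -> k^o := f \o antipode.
Definition grouplike_inv y : H := antipode y.

Lemma dual_invl (alpha : {lrmorphism H -> k^o}) :
  conv (dual_inv alpha) alpha =1 counit.
Proof.
move=> h; have := congr1 alpha (antipodel h).
rewrite linearZ /= rmorph1 [_ *: 1]mulr1 /conv /tlift => <-.
by rewrite raddf_sum; apply: eq_bigr => p _; rewrite /= rmorphM.
Qed.

Lemma dual_invr (alpha : {lrmorphism H -> k^o}) :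
  conv alpha (dual_inv alpha) =1 counit.
Proof.
move=> h; have := congr1 alpha (antipoder h).
rewrite linearZ /= rmorph1 [_ *: 1]mulr1 /conv /tlift => <-.
by rewrite raddf_sum; apply: eq_bigr => p _; rewrite /= rmorphM.
Qed.

Lemma grouplike_invl y : grouplike y -> grouplike_inv y * y = 1.
Proof.
move=> [dy ey]; have := antipodel y; rewrite dy ey scale1r tlift_tprod //.
- by move=> v a u u'; rewrite antipode_linear mulrDl scalerAl.
- by move=> u a v v'; rewrite mulrDr scalerAr.
Qed.

Lemma grouplike_invr y : grouplike y -> y * grouplike_inv y = 1.
Proof.
move=> [dy ey]; have := antipoder y; rewrite dy ey scale1r tlift_tprod //.
- by move=> v a u u'; rewrite mulrDl scalerAl.
- by move=> u a v v'; rewrite antipode_linear mulrDr scalerAr.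
Qed.

Definition yd_pair (alpha : {lrmorphism H -> k^o}) (y : H) : Prop :=
  [/\ grouplike y,
      alpha y = -1 &
      forall h, rhit (lhit alpha h) (dual_inv alpha) = y * h * grouplike_inv y].

End Functionals.

Section YetterDrinfeld.
Variables (k : fieldType) (H : hopfAlgType k).

Record is_left_module (M : lmodType k) (act : H -> M -> M) : Prop :=
  IsLeftModule {
    act_linearl : forall m, linear (act^~ m);
    act_linearr : forall h, linear (act h);
    act1 : forall m, act 1 m = m;
    actM : forall g h m, act (g * h) m = act g (act h m)
  }.

Record is_left_comodule (M : lmodType k) (coact : M -> {tensor H & M}) : Prop :=
  IsLeftComodule {
    coact_linear : linear coact;
    coact_coassoc : forall m,
      \sw_(a, m0 <- coact m) \sw_(a1, a2 <- comul a) a1 \ox (a2 \ox m0) =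
      \sw_(a, m0 <- coact m) a \ox coact m0;
    coact_counit : forall m, \sw_(a, m0 <- coact m) (counit a : k) *: m0 = m
  }.

Record is_yd_module (M : lmodType k) (act : H -> M -> M)
    (coact : M -> {tensor H & M}) : Prop := IsYDModule {
  yd_module : is_left_module act;
  yd_comodule : is_left_comodule coact;
  yd_compat : forall h m,
    \sw_(h1, h2 <- comul h) \sw_(a, m0 <- coact m) (h1 * a) \ox act h2 m0 =
    \sw_(h1, h2 <- comul h) \sw_(a, m0 <- coact (act h1 m)) (a * h2) \ox m0
}.

Definition Hlinear (M N : lmodType k) (actM : H -> M -> M) (actN : H -> N -> N)
    (f : M -> N) : Prop :=
  forall h m, f (actM h m) = actN h (f m).

Definition Hcolinear (M N : lmodType k) (coactM : M -> {tensor H & M})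
    (coactN : N -> {tensor H & N}) (f : M -> N) : Prop :=
  forall m, coactN (f m) = \sw_(a, m0 <- coactM m) a \ox f m0.

Record ydData := YDData {
  yd_sort :> algType k;
  yd_act : H -> yd_sort -> yd_sort;
  yd_coact : yd_sort -> {tensor H & yd_sort};
  yd_comul : yd_sort -> {tensor yd_sort & yd_sort};
  yd_counit : yd_sort -> k^o
}.

Section YDHopf.
Variable B : ydData.
Local Notation act := (@yd_act B).
Local Notation coact := (@yd_coact B).
Local Notation delta := (@yd_comul B).
Local Notation eps := (@yd_counit B).

Record is_yd_bialgebra : Prop := IsYDBialgebra {
  ydb_module : is_yd_module act coact;
  ydb_coalgebra : is_coalgebra delta eps;
  ydb_act1 : forall h, act h 1 = (counit h : k) *: 1;
  ydb_actM : forall h b c,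
    act h (b * c) = \sw_(h1, h2 <- comul h) act h1 b * act h2 c;
  ydb_coact1 : coact 1 = 1 \ox 1;
  ydb_coactM : forall b c, coact (b * c) =
    \sw_(a, b0 <- coact b) \sw_(d, c0 <- coact c) (a * d) \ox (b0 * c0);
  ydb_counit_act : forall h b, eps (act h b) = counit h * eps b;
  ydb_comul_act : forall h b, delta (act h b) =
    \sw_(h1, h2 <- comul h) \sw_(b1, b2 <- delta b) act h1 b1 \ox act h2 b2;
  ydb_counit_coact : forall b,
    \sw_(a, b0 <- coact b) (eps b0 : k) *: a = (eps b : k) *: 1;
  ydb_comul_coact : forall b,
    \sw_(a, b0 <- coact b) a \ox delta b0 =
    \sw_(b1, b2 <- delta b) \sw_(a1, b10 <- coact b1)
      \sw_(a2, b20 <- coact b2) (a1 * a2) \ox (b10 \ox b20);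
  ydb_counit1 : eps 1 = 1;
  ydb_counitM : forall b c, eps (b * c) = eps b * eps c;
  ydb_comul1 : delta 1 = 1 \ox 1;
  ydb_comulM : forall b c, delta (b * c) =
    \sw_(b1, b2 <- delta b) \sw_(a, b20 <- coact b2) \sw_(c1, c2 <- delta c)
      (b1 * act a c1) \ox (b20 * c2)
}.

Record is_yd_antipode (S : B -> B) : Prop := IsYDAntipode {
  yd_antipode_linear : linear S;
  yd_antipode_Hlinear : Hlinear act act S;
  yd_antipode_Hcolinear : Hcolinear coact coact S;
  yd_antipodel : forall b, \sw_(b1, b2 <- delta b) S b1 * b2 = (eps b : k) *: 1;
  yd_antipoder : forall b, \sw_(b1, b2 <- delta b) b1 * S b2 = (eps b : k) *: 1
}.

Definition is_yd_hopf : Prop :=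
  is_yd_bialgebra /\ exists S : B -> B, is_yd_antipode S.

End YDHopf.

(* No condition on antipodes: an isomorphism of bialgebras transports one
   antipode to the other, since antipodes are unique. *)
Definition yd_isomorphic (B C : ydData) : Prop :=
  exists phi : {lrmorphism B -> C},
    [/\ bijective phi,
        Hlinear (@yd_act B) (@yd_act C) phi,
        Hcolinear (@yd_coact B) (@yd_coact C) phi,
        forall b, yd_comul (phi b) =
                  \sw_(b1, b2 <- yd_comul b) phi b1 \ox phi b2 &
        forall b, yd_counit (phi b) = yd_counit b].

Definition trivial_act (M : lmodType k) (h : H) (m : M) : M :=
  (counit h : k) *: m.
Definition trivial_coact (M : lmodType k) (m : M) : {tensor H & M} := 1 \ox m.

End YetterDrinfeld.


(* DualNumber a b stands for a 1 + b n. *)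
Record dual_number (k : fieldType) : Type :=
  DualNumber { dn_fst : k; dn_snd : k }.

Section DualNumber.
Variable k : fieldType.
Local Notation D := (dual_number k).

Let dn_pair (x : D) : k * k := (dn_fst x, dn_snd x).
Let dn_unpair (p : k * k) : D := DualNumber p.1 p.2.
Let dn_pairK : cancel dn_pair dn_unpair. Proof. by case. Qed.
HB.instance Definition _ := Choice.copy D (can_type dn_pairK).

Definition dn_zero : D := DualNumber 0 0.
Definition dn_add (x y : D) : D :=
  DualNumber (dn_fst x + dn_fst y) (dn_snd x + dn_snd y).
Definition dn_opp (x : D) : D := DualNumber (- dn_fst x) (- dn_snd x).
Definition dn_scale (a : k) (x : D) : D :=
  DualNumber (a * dn_fst x) (a * dn_snd x).
Definition dn_one : D := DualNumber 1 0.
Definition dn_mul (x y : D) : D :=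
  DualNumber (dn_fst x * dn_fst y) (dn_fst x * dn_snd y + dn_snd x * dn_fst y).

Let dn_addA : associative dn_add.
Proof. by case=> a b [c d] [e f]; congr DualNumber; apply: addrA. Qed.
Let dn_addC : commutative dn_add.
Proof. by case=> a b [c d]; congr DualNumber; apply: addrC. Qed.
Let dn_add0 : left_id dn_zero dn_add.
Proof. by case=> a b; congr DualNumber; apply: add0r. Qed.
Let dn_addN : left_inverse dn_zero dn_opp dn_add.
Proof. by case=> a b; congr DualNumber; apply: addNr. Qed.
HB.instance Definition _ :=
  GRing.isZmodule.Build D dn_addA dn_addC dn_add0 dn_addN.

Let dn_scaleA a b x : dn_scale a (dn_scale b x) = dn_scale (a * b) x.
Proof. by congr DualNumber; apply: mulrA. Qed.
Let dn_scale1 : left_id 1 dn_scale.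
Proof. by case=> a b; congr DualNumber; apply: mul1r. Qed.
Let dn_scaleDr : right_distributive dn_scale +%R.
Proof. by move=> a x y; congr DualNumber; apply: mulrDr. Qed.
Let dn_scaleDl x : {morph dn_scale^~ x : a b / a + b}.
Proof. by move=> a b; congr DualNumber; apply: mulrDl. Qed.
HB.instance Definition _ := GRing.Zmodule_isLmodule.Build k D
  dn_scaleA dn_scale1 dn_scaleDr dn_scaleDl.

Let dn_mulA : associative dn_mul.
Proof.
move=> x y z; congr DualNumber => /=; first exact: mulrA.
by rewrite mulrDr mulrDl !mulrA addrA.
Qed.
Let dn_mul1l : left_id dn_one dn_mul.
Proof. by case=> a b; rewrite /dn_mul /= !mul1r mul0r addr0. Qed.
Let dn_mul1r : right_id dn_one dn_mul.
Proof. by case=> a b; rewrite /dn_mul /= !mulr1 mulr0 add0r. Qed.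
Let dn_mulDl : left_distributive dn_mul +%R.
Proof. by move=> x y z; congr DualNumber; rewrite /= !mulrDl // addrACA. Qed.
Let dn_mulDr : right_distributive dn_mul +%R.
Proof. by move=> x y z; congr DualNumber; rewrite /= !mulrDr // addrACA. Qed.
Let dn_one_neq0 : dn_one != 0.
Proof. by apply/eqP => -[/eqP]; rewrite oner_eq0. Qed.
HB.instance Definition _ := GRing.Zmodule_isNzRing.Build D
  dn_mulA dn_mul1l dn_mul1r dn_mulDl dn_mulDr dn_one_neq0.

Let dn_scaleAl (a : k) (x y : D) : a *: (x * y) = (a *: x) * y.
Proof. by congr DualNumber => /=; rewrite ?mulrDr !mulrA. Qed.
HB.instance Definition _ := GRing.Lmodule_isLalgebra.Build k D dn_scaleAl.

Let dn_scaleAr (a : k) (x y : D) : a *: (x * y) = x * (a *: y).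
Proof.
by congr DualNumber => /=; rewrite ?mulrDr mulrCA // (mulrCA a (dn_snd x)).
Qed.
HB.instance Definition _ := GRing.Lalgebra_isAlgebra.Build k D dn_scaleAr.

Definition dn_n : D := DualNumber 0 1.

Lemma dn_nn : dn_n * dn_n = 0.
Proof. by congr DualNumber; rewrite /= ?mul0r ?mulr0 ?addr0. Qed.

Lemma dn_basis (x : D) : x = dn_fst x *: 1 + dn_snd x *: dn_n.
Proof.
by case: x => a b; congr DualNumber; rewrite /= !(mulr1, mulr0, addr0, add0r).
Qed.

Variables (H : hopfAlgType k) (alpha : H -> k^o) (y : H).

Definition Balpha_y : ydData H := @YDData k H D
  (fun h x => DualNumber ((counit h : k) * dn_fst x) ((alpha h : k) * dn_snd x))
  (fun x => dn_fst x *: (1 \ox 1) + dn_snd x *: (y \ox dn_n))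
  (fun x => dn_fst x *: (1 \ox 1) + dn_snd x *: (dn_n \ox 1 + 1 \ox dn_n))
  (fun x => dn_fst x).

End DualNumber.

(* GroupAlgebra f stands for the sum of the f(g) g over g in G. *)
Record group_algebra (k : fieldType) (G : finZmodType) : Type :=
  GroupAlgebra { ga_coef :> {ffun G -> k} }.

Section GroupAlgebra.
Variables (k : fieldType) (G : finZmodType).
Local Notation kG := (group_algebra k G).

Let ga_coefK : cancel (@ga_coef k G) (@GroupAlgebra k G). Proof. by case. Qed.
HB.instance Definition _ := Choice.copy kG (can_type ga_coefK).

Lemma ga_eqP (f1 f2 : kG) : f1 =1 f2 <-> f1 = f2.
Proof. by split=> [/ffunP|-> //]; case: f1 f2 => ? [?] /= ->. Qed.

Definition ga_zero : kG := GroupAlgebra [ffun=> 0].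
Definition ga_add (f1 f2 : kG) : kG := GroupAlgebra [ffun x => f1 x + f2 x].
Definition ga_opp (f : kG) : kG := GroupAlgebra [ffun x => - f x].
Definition ga_scale (a : k) (f : kG) : kG := GroupAlgebra [ffun x => a * f x].
Definition ga_of (g : G) : kG := GroupAlgebra [ffun x => (x == g)%:R].
Definition ga_mul (f1 f2 : kG) : kG :=
  GroupAlgebra [ffun x => \sum_y f1 y * f2 (x - y)].

Let ga_addA : associative ga_add.
Proof. by move=> f g h; apply/ga_eqP => x; rewrite !ffunE addrA. Qed.
Let ga_addC : commutative ga_add.
Proof. by move=> f g; apply/ga_eqP => x; rewrite !ffunE addrC. Qed.
Let ga_add0 : left_id ga_zero ga_add.
Proof. by move=> f; apply/ga_eqP => x; rewrite !ffunE add0r. Qed.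
Let ga_addN : left_inverse ga_zero ga_opp ga_add.
Proof. by move=> f; apply/ga_eqP => x; rewrite !ffunE addNr. Qed.
HB.instance Definition _ :=
  GRing.isZmodule.Build kG ga_addA ga_addC ga_add0 ga_addN.

Let ga_scaleA a b f : ga_scale a (ga_scale b f) = ga_scale (a * b) f.
Proof. by apply/ga_eqP => x; rewrite !ffunE mulrA. Qed.
Let ga_scale1 : left_id 1 ga_scale.
Proof. by move=> f; apply/ga_eqP => x; rewrite !ffunE mul1r. Qed.
Let ga_scaleDr : right_distributive ga_scale +%R.
Proof. by move=> a f g; apply/ga_eqP => x; rewrite !ffunE mulrDr. Qed.
Let ga_scaleDl f : {morph ga_scale^~ f : a b / a + b}.
Proof. by move=> a b; apply/ga_eqP => x; rewrite !ffunE mulrDl. Qed.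
HB.instance Definition _ := GRing.Zmodule_isLmodule.Build k kG
  ga_scaleA ga_scale1 ga_scaleDr ga_scaleDl.

Let ga_mulA : associative ga_mul.
Proof.
move=> f1 f2 f3; apply/ga_eqP => x; rewrite !ffunE.
under eq_bigr do rewrite ffunE mulr_sumr.
under [RHS]eq_bigr do rewrite ffunE mulr_suml.
rewrite [RHS]exchange_big /=; apply: eq_bigr => y _.
rewrite (reindex_inj (addIr (- y))) /=; apply: eq_bigr => z _.
by rewrite mulrA opprB addrA subrK.
Qed.
Let ga_mul1l : left_id (ga_of 0) ga_mul.
Proof.
move=> f; apply/ga_eqP => x; rewrite ffunE (bigD1 0) //= ffunE eqxx mul1r subr0.
by rewrite big1 ?addr0 // => y /negPf hy; rewrite ffunE hy mul0r.
Qed.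
Let ga_mul1r : right_id (ga_of 0) ga_mul.
Proof.
move=> f; apply/ga_eqP => x; rewrite ffunE (bigD1 x) //= ffunE subrr eqxx mulr1.
rewrite big1 ?addr0 // => y /negPf hy.
by rewrite ffunE subr_eq0 eq_sym hy mulr0.
Qed.
Let ga_mulDl : left_distributive ga_mul +%R.
Proof.
move=> f g h; apply/ga_eqP => x; rewrite !ffunE -big_split /=.
by apply: eq_bigr => y _; rewrite ffunE mulrDl.
Qed.
Let ga_mulDr : right_distributive ga_mul +%R.
Proof.
move=> f g h; apply/ga_eqP => x; rewrite !ffunE -big_split /=.
by apply: eq_bigr => y _; rewrite ffunE mulrDr.
Qed.
Let ga_one_neq0 : ga_of 0 != 0.
Proof.
by apply/eqP => /ga_eqP /(_ 0) /eqP; rewrite !ffunE eqxx oner_eq0.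
Qed.
HB.instance Definition _ := GRing.Zmodule_isNzRing.Build kG
  ga_mulA ga_mul1l ga_mul1r ga_mulDl ga_mulDr ga_one_neq0.

Let ga_scaleAl (a : k) (f g : kG) : a *: (f * g) = (a *: f) * g.
Proof.
apply/ga_eqP => x; rewrite !ffunE mulr_sumr.
by apply: eq_bigr => y _; rewrite ffunE mulrA.
Qed.
HB.instance Definition _ := GRing.Lmodule_isLalgebra.Build k kG ga_scaleAl.

Let ga_scaleAr (a : k) (f g : kG) : a *: (f * g) = f * (a *: g).
Proof.
apply/ga_eqP => x; rewrite !ffunE mulr_sumr.
by apply: eq_bigr => y _; rewrite ffunE mulrCA.
Qed.
HB.instance Definition _ := GRing.Lalgebra_isAlgebra.Build k kG ga_scaleAr.

Lemma ga_ofD (g h : G) : ga_of g * ga_of h = ga_of (g + h).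
Proof.
apply/ga_eqP => x; rewrite !ffunE (bigD1 g) //= !ffunE eqxx mul1r.
rewrite big1 ?addr0 => [|y /negPf hy]; last by rewrite ffunE hy mul0r.
by rewrite subr_eq addrC.
Qed.

Definition trivial_group_algebra (H : hopfAlgType k) : ydData H :=
  @YDData k H kG (@trivial_act k H kG) (@trivial_coact k H kG)
    (fun f => \sum_g f g *: (ga_of g \ox ga_of g)) (fun f => \sum_g f g).

End GroupAlgebra.

(* Main.v *)
From HB Require Import structures.
Require Import Defs.
From mathcomp Require Import all_boot all_algebra.
From mathcomp Require Import ring.
Set Implicit Arguments.
Unset Strict Implicit.
Unset Printing Implicit Defensive.
Import GRing.Theory.
Local Open Scope ring_scope.

(** Let B be a two-dimensional bialgebra in the Yetter-Drinfel'd category. The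
    counit of B is a morphism and an algebra map, so its kernel is a
    one-dimensional ideal, submodule and subcomodule; choose n spanning it.
    Then H acts on n through an algebra map alpha, coacts on n through a
    grouplike y, and, by the counit axioms,

      n n = c n,    Delta(n) = n (x) 1 + 1 (x) n + d n (x) n

    for two scalars c and d ([yd_bialgebra_basis]). So B is determined up to
    isomorphism by the quadruple (alpha, y, c, d) ([basis_iso]), and what
    remains is to find out which quadruples occur.

    - The Yetter-Drinfel'd condition at n reads
      (alpha -> h) y = y (h <- alpha), which is equivalent to
      alpha -> h <- alpha^-1 = y h y^-1 ([basis_compat], [yd_pairE]).
    - Linearity of the product forces c (alpha * alpha) = c alpha, hence
      alpha = epsilon when c is nonzero, since alpha is invertible for the
      convolution. In the same way y = 1 when c is nonzero, and
      alpha = epsilon when d is nonzero ([basis_char_mul],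
      [basis_grouplike1], [basis_char_comul]).
    - Multiplicativity of Delta at n n, read off at n (x) n, is the equation
      cd = 1 + alpha(y) + 2 cd + 2 cd alpha(y) + (cd)^2 alpha(y)
      ([basis_comulM_eq]).
    - An antipode exists only if cd differs from -1, because S(n) must be a
      multiple s n with s (1 + cd) = -1 ([basis_antipode_neq]).

    If c is nonzero, then alpha = epsilon and y = 1, the equation becomes
    (cd + 1)(cd + 2) = 0, and so cd = -2. In that case 1 + d n is a grouplike
    of square 1, and B is the group algebra of Z/2 with trivial structures
    ([Z2_group_algebra_basis]). If c = 0, then the equation gives
    alpha(y) = -1; a nonzero d would give alpha(y) = 1, so d = 0 since 2 is
    invertible, and B is B_{alpha,y} ([Balpha_y_basis]).

    Conversely, for c = d = 0 and a pair (alpha, y) as above, all axioms can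
    be checked on the basis 1, n ([basis_bialgebra]); the condition
    alpha(y) = -1 is what makes Delta(n) Delta(n) vanish. *)

(** * Linear and bilinear maps as predicates *)

Section LinearMaps.
Variables (k : fieldType) (U V : lmodType k).
Implicit Types f g : U -> V.

Lemma linD f : linear f -> forall x y, f (x + y) = f x + f y.
Proof. by move=> fl x y; have := fl 1 x y; rewrite !scale1r. Qed.

Lemma lin0 f : linear f -> f 0 = 0.
Proof. by move=> fl; have := fl (-1) 0 0; rewrite scaler0 addr0 scaleN1r addNr. Qed.

Lemma linZ f : linear f -> forall a x, f (a *: x) = a *: f x.
Proof. by move=> fl a x; have := fl a x 0; rewrite lin0 // !addr0. Qed.

End LinearMaps.

Section Closure.
Variables (k : fieldType) (U V W : lmodType k).
Implicit Types f g : U -> V.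

Definition bilin (F : U -> V -> W) : Prop :=
  (forall v, linear (F^~ v)) /\ (forall u, linear (F u)).

Lemma linear_id : linear (id : U -> U).
Proof. by []. Qed.

Lemma linear_comp (f : V -> W) (g : U -> V) :
  linear f -> linear g -> linear (fun x => f (g x)).
Proof. by move=> fl gl a x y; rewrite gl fl. Qed.

Lemma linear_add f g : linear f -> linear g -> linear (fun x => f x + g x).
Proof. by move=> fl gl a x y; rewrite fl gl scalerDr addrACA. Qed.

Lemma linear_opp f : linear f -> linear (fun x => - f x).
Proof. by move=> fl a x y; rewrite fl opprD scalerN. Qed.

Lemma linear_scalel (v : V) : linear (fun a : k^o => (a : k) *: v).
Proof. by move=> a x y; rewrite scalerDl scalerA. Qed.

(** Stated separately from composition with a linear map: the scalar is typed in
    k, which is not a module over itself, while g takes values in k^o. *)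
Lemma linear_scalef (g : U -> k^o) (v : V) :
  linear g -> linear (fun x => (g x : k) *: v).
Proof. by move=> gl a x y; rewrite gl scalerDl scalerA. Qed.

Lemma linear_mulf (g : U -> k^o) (c : k^o) :
  linear g -> linear (fun x => g x * c).
Proof. by move=> gl a x y; rewrite gl mulrDl -scalerAl. Qed.

Lemma linear_mulfr (g : U -> k^o) (c : k^o) :
  linear g -> linear (fun x => c * g x).
Proof. by move=> gl a x y; rewrite gl mulrDr -scalerAr. Qed.

Lemma linear_scaler (c : k) : linear (fun v : V => c *: v).
Proof. by move=> a x y; rewrite scalerDr !scalerA mulrC. Qed.

Lemma linear_tprodl (v : V) : linear (fun u : U => u \ox v).
Proof. by move=> a x y; rewrite tprodDl tprodZl. Qed.

Lemma linear_tprodr (u : U) : linear (fun v : V => u \ox v).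
Proof. by move=> a x y; rewrite tprodDr tprodZr. Qed.

Lemma linear_tlift (T : lmodType k) (F : T -> U -> V -> W) t :
  (forall u v, linear (fun x => F x u v)) -> linear (fun x => tlift (F x) t).
Proof.
move=> Fl a x y; rewrite /tlift scaler_sumr -big_split /=.
by apply: eq_bigr => p _; rewrite Fl.
Qed.

Lemma tlift_lin (F : U -> V -> W) : bilin F -> linear (tlift F).
Proof. by case=> Fl Fr; apply: tlift_linear. Qed.

Lemma tlift_pure (F : U -> V -> W) u v :
  bilin F -> tlift F (u \ox v) = F u v.
Proof. by case=> Fl Fr; apply: tlift_tprod. Qed.

Lemma tliftD (F : U -> V -> W) s t :
  bilin F -> tlift F (s + t) = tlift F s + tlift F t.
Proof. by move/tlift_lin/linD. Qed.

Lemma tliftZ (F : U -> V -> W) a t :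
  bilin F -> tlift F (a *: t) = a *: tlift F t.
Proof. by move/tlift_lin/linZ. Qed.

Lemma tlift_add (F G : U -> V -> W) t :
  tlift (fun u v => F u v + G u v) t = tlift F t + tlift G t.
Proof. exact: big_split. Qed.

Lemma tlift_zero t : tlift (fun (_ : U) (_ : V) => 0 : W) t = 0.
Proof. exact: big1_eq. Qed.

Lemma eq_tlift (F G : U -> V -> W) t :
  (forall u v, F u v = G u v) -> tlift F t = tlift G t.
Proof. by move=> FG; apply: eq_bigr => p _; apply: FG. Qed.

Lemma lin_tlift (T : lmodType k) (f : W -> T) (F : U -> V -> W) t :
  linear f -> f (tlift F t) = tlift (fun u v => f (F u v)) t.
Proof.
move=> fl; rewrite /tlift.
elim: (repr t) => [|p s ih]; first by rewrite !big_nil (lin0 fl).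
by rewrite !big_cons (linD fl) ih.
Qed.

End Closure.

Section LinAlg.
Variables (k : fieldType) (A : algType k).
Lemma linear_mull (c : A) : linear (fun x : A => x * c).
Proof. by move=> a x y; rewrite mulrDl scalerAl. Qed.
Lemma linear_mulr (c : A) : linear (fun x : A => c * x).
Proof. by move=> a x y; rewrite mulrDr scalerAr. Qed.
End LinAlg.

Section Tens.
Variables (k : fieldType) (U V W : lmodType k).
Lemma tprod0l (v : V) : (0 : U) \ox v = 0.
Proof. exact: lin0 (linear_tprodl v). Qed.
Lemma tprod0r (u : U) : u \ox (0 : V) = 0.
Proof. exact: lin0 (linear_tprodr u). Qed.
Lemma linear_tensor_ext (f g : {tensor U & V} -> W) : linear f -> linear g ->
  (forall u v, f (u \ox v) = g (u \ox v)) -> f =1 g.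
Proof.
move=> fl gl fg x; pose F u v := f (u \ox v).
have fE : f =1 tlift F by apply: tlift_unique.
have gE : g =1 tlift F by apply: tlift_unique => // u v; rewrite -fg.
by rewrite fE gE.
Qed.
End Tens.

Section HopfLinear.
Variables (k : fieldType) (H : hopfAlgType k).
Lemma comul_linear : linear (@comul k H).
Proof. exact: coalg_comul_linear (hopf_coalgebra (s := H)). Qed.
Lemma counit_linear : linear (@counit k H).
Proof. exact: coalg_counit_linear (hopf_coalgebra (s := H)). Qed.
End HopfLinear.

(** [lin] proves that an expression is linear, or bilinear, in its bound
    variables by following its syntax. The structure maps are plain functions,
    so their linearity is looked up in the context, except for those of a Hopf
    algebra: the fact about every other map that occurs has to be there. *)
Ltac lin_fact :=
  solve [ assumption | apply: linearP
        | match goal with H : context [GRing.linear_for] |- _ => exact: H end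
        | apply: linear_scalel | apply: linear_scaler | apply: linear_tprodl
        | apply: linear_tprodr | apply: linear_mull | apply: linear_mulr
        | exact: comul_linear
        | exact: counit_linear
        | exact: antipode_linear ].

Ltac lin_step :=
  cbv beta;
  match goal with
  | |- forall _, _ => intro
  | |- bilin _ => split=> ?
  | |- GRing.linear_for _ (fun x => x) => exact: linear_id
  | |- GRing.linear_for _ (fun x => tlift (@?F x) ?t) =>
      apply: linear_tlift => ? ?
  | |- GRing.linear_for _ (fun x => tlift ?F (@?t x)) =>
      apply: (linear_comp (f := tlift F)); [apply: tlift_lin | ]
  | |- GRing.linear_for _ (tlift ?F) => apply: tlift_lin
  | |- GRing.linear_for _ (fun x => @?f x + @?g x) => apply: linear_add
  | |- GRing.linear_for _ (fun x => - @?f x) => apply: linear_opp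
  | |- GRing.linear_for _ (fun x => GRing.scale (@?g x) _) =>
      apply: linear_scalef
  | |- GRing.linear_for _ (fun x => GRing.mul (@?g x) _) => apply: linear_mulf
  | |- GRing.linear_for _ (fun x => GRing.mul _ (@?g x)) => apply: linear_mulfr
  | |- _ => lin_fact
  | |- GRing.linear_for _ (fun x => ?f (@?g x)) =>
      apply: (linear_comp (f := f) (g := g)); [lin_fact | ]
  | |- GRing.linear_for _ (fun x => ?f (@?g x) ?c) =>
      apply: (linear_comp (f := fun z => f z c) (g := g)); [lin_fact | ]
  end.
Ltac lin := solve [repeat lin_step].


(** Evaluates Sweedler sums over explicit tensors. The side conditions are
    bilinearity of the summand, without which such a sum would depend on the
    representative of the tensor. *)
Ltac sweval := repeat first
  [ rewrite tlift_pure; last by lin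
  | rewrite tliftD; last by lin
  | rewrite tliftZ; last by lin ].

(** * Convolution and the hit actions *)

Section Functionals.
Variables (k : fieldType) (H : hopfAlgType k).
Implicit Types (f g : H -> k^o) (h y : H).

(** Coassociativity as it is used in Sweedler notation: the two ways of applying
    the coproduct twice agree under any trilinear F. *)
Lemma sw_coassoc (W : lmodType k) (F : H -> H -> H -> W) h :
  (forall a b, linear (fun x => F x a b)) ->
  (forall a b, linear (fun x => F a x b)) ->
  (forall a b, linear (fun x => F a b x)) ->
  \sw_(a, b <- comul h) \sw_(a1, a2 <- comul a) F a1 a2 b =
  \sw_(a, b <- comul h) \sw_(b1, b2 <- comul b) F a b1 b2.
Proof.
move=> F1 F2 F3.
pose G := tlift (fun a t => \sw_(b, c <- t) F a b c).
have Gl : linear G by rewrite /G; lin.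
have := congr1 G (coalg_coassoc hopf_coalgebra h).
rewrite !(lin_tlift _ _ Gl) => E; etransitivity; [|etransitivity; [exact: E|]].
- apply: eq_tlift => a b; rewrite (lin_tlift _ _ Gl); apply: eq_tlift => c d.
  by rewrite /G !tlift_pure //; lin.
- by apply: eq_tlift => a b; rewrite /G tlift_pure //; lin.
Qed.

Lemma sw_counitl (W : lmodType k) (G : H -> W) h : linear G ->
  \sw_(h1, h2 <- comul h) (counit h1 : k) *: G h2 = G h.
Proof.
move=> Gl; rewrite -[in RHS](coalg_counitl hopf_coalgebra h) (lin_tlift _ _ Gl).
by apply: eq_tlift => a b; rewrite (linZ Gl).
Qed.

Lemma sw_counitr (W : lmodType k) (G : H -> W) h : linear G ->
  \sw_(h1, h2 <- comul h) (counit h2 : k) *: G h1 = G h.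
Proof.
move=> Gl; rewrite -[in RHS](coalg_counitr hopf_coalgebra h) (lin_tlift _ _ Gl).
by apply: eq_tlift => a b; rewrite (linZ Gl).
Qed.

Lemma rhit_linear f : linear f -> linear (fun h => rhit h f).
Proof. by move=> fl; rewrite /rhit; lin. Qed.

Lemma lhit_linear f : linear f -> linear (lhit f).
Proof. by move=> fl; rewrite /lhit; lin. Qed.

Lemma rhit_rhit f g h : linear f -> linear g ->
  rhit (rhit h f) g = rhit h (conv f g).
Proof.
move=> fl gl; have gl' := rhit_linear gl; rewrite {2}/rhit (lin_tlift _ _ gl').
pose F a b c : H := (f a : k) *: ((g b : k) *: c).
transitivity (\sw_(a, b <- comul h) \sw_(b1, b2 <- comul b) F a b1 b2).
  apply: eq_tlift => a b.
  by rewrite (linZ gl') /F -(lin_tlift _ _ (linear_scaler _)).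
rewrite -sw_coassoc; try by rewrite /F; lin.
apply: eq_tlift => a b; rewrite /conv.
rewrite (lin_tlift _ (comul a) (linear_scalel b)); apply: eq_tlift => c d.
by rewrite /F scalerA.
Qed.

Lemma lhit_rhit f g h : linear f -> linear g ->
  lhit f (rhit h g) = rhit (lhit f h) g.
Proof.
move=> fl gl; have gl' := rhit_linear gl; have fl' := lhit_linear fl.
pose F a b c : H := (g a : k) *: ((f c : k) *: b).
rewrite {1}/rhit {2}/lhit (lin_tlift _ _ fl') (lin_tlift _ _ gl').
transitivity (\sw_(a, b <- comul h) \sw_(b1, b2 <- comul b) F a b1 b2).
  apply: eq_tlift => a b.
  by rewrite (linZ fl') /F -(lin_tlift _ _ (linear_scaler _)).
rewrite -sw_coassoc; try by rewrite /F; lin.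
apply: eq_tlift => a b; rewrite (linZ gl') /rhit.
rewrite (lin_tlift _ (comul a) (linear_scaler _)); apply: eq_tlift => c d.
by rewrite /F !scalerA mulrC.
Qed.

Lemma rhit_counit h : rhit h (@counit k H) = h.
Proof. by rewrite /rhit; apply: (sw_counitl (G := id)). Qed.

Lemma eq_conv f f' g g' : f =1 f' -> g =1 g' -> conv f g =1 conv f' g'.
Proof. by move=> ff gg h; apply: eq_tlift => a b; rewrite ff gg. Qed.

Lemma eq_rhit h f g : f =1 g -> rhit h f = rhit h g.
Proof. by move=> fg; apply: eq_tlift => a b; rewrite fg. Qed.

Lemma conv_rhit f g h : linear g -> conv f g h = g (rhit h f).
Proof.
move=> gl; rewrite /rhit (lin_tlift _ _ gl); apply: eq_tlift => a b.
by rewrite (linZ gl).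
Qed.

Lemma conv_counitl f : linear f -> conv (@counit k H) f =1 f.
Proof. by move=> fl h; rewrite conv_rhit // rhit_counit. Qed.

Lemma convA f g l : linear f -> linear g -> linear l ->
  conv f (conv g l) =1 conv (conv f g) l.
Proof.
move=> fl gl ll h.
have cl : linear (conv g l) by rewrite /conv; lin.
by rewrite !conv_rhit // rhit_rhit.
Qed.

Lemma dual_inv_linear (alpha : {lrmorphism H -> k^o}) : linear (dual_inv alpha).
Proof. rewrite /dual_inv /comp; lin. Qed.

(** Algebra maps to k are invertible for convolution, and the only idempotent of
    a group is its unit. *)
Lemma idempotent_alg_map (alpha : {lrmorphism H -> k^o}) :
  conv alpha alpha =1 alpha -> alpha =1 @counit k H.
Proof.
move=> aa h; have al : linear alpha := linearP alpha.
have il := dual_inv_linear alpha.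
rewrite -(dual_invl alpha) -(eq_conv (frefl (dual_inv alpha)) aa) convA //.
by rewrite (eq_conv (dual_invl alpha) (frefl _)) conv_counitl.
Qed.

(** Apply the identity on the left to h <- alpha, or the one on the right to
    h <- alpha^-1: the two hit actions commute, and those of alpha and alpha^-1
    cancel. *)
Lemma yd_pairE (alpha : {lrmorphism H -> k^o}) y : grouplike y ->
  (forall h, rhit (lhit alpha h) (dual_inv alpha) = y * h * grouplike_inv y) <->
  (forall h, lhit alpha h * y = y * rhit h alpha).
Proof.
move=> gy; have al : linear alpha := linearP alpha.
have il := dual_inv_linear alpha.
have yV := grouplike_invl gy; have Vy := grouplike_invr gy.
split=> E h.
  have := E (rhit h alpha).
  rewrite lhit_rhit // rhit_rhit // (eq_rhit _ (dual_invr alpha)) rhit_counit => ->.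
  by rewrite -mulrA yV mulr1.
have := E (rhit h (dual_inv alpha)).
rewrite rhit_rhit // (eq_rhit _ (dual_invl alpha)) rhit_counit lhit_rhit //.
by move <-; rewrite -mulrA Vy mulr1.
Qed.

End Functionals.

(** * Yetter-Drinfel'd data with a basis 1, n *)

(** 1 and n form a basis on which all structure maps are explicit, in terms of a
    functional alpha, an element y of H and two scalars c and d. The coordinate
    of b on 1 is its counit, and nu b is its coordinate on n. The four parameters
    are not related to each other: which quadruples come from a bialgebra, or
    from a Hopf algebra, is decided later. *)
Record has_yd_basis (k : fieldType) (H : hopfAlgType k) (B : ydData H)
    (nu : B -> k^o) (n : B) (alpha : H -> k^o) (y : H) (c d : k) : Prop :=
  HasYDBasis {
    basis_nu : linear nu;
    basis_nu1 : nu 1 = 0;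
    basis_nun : nu n = 1;
    basis_dec : forall b, b = (yd_counit b : k) *: 1 + (nu b : k) *: n;
    basis_counit : linear (@yd_counit k H B);
    basis_counit1 : yd_counit (1 : B) = 1;
    basis_counitn : yd_counit n = 0;
    basis_mul : n * n = c *: n;
    basis_act : forall h, linear (@yd_act k H B h);
    basis_act1 : forall h, yd_act h (1 : B) = (counit h : k) *: 1;
    basis_actn : forall h, yd_act h n = (alpha h : k) *: n;
    basis_coact : linear (@yd_coact k H B);
    basis_coact1 : yd_coact (1 : B) = 1 \ox 1;
    basis_coactn : yd_coact n = y \ox n;
    basis_comul : linear (@yd_comul k H B);
    basis_comul1 : yd_comul (1 : B) = 1 \ox 1;
    basis_comuln : yd_comul n = n \ox 1 + 1 \ox n + d *: (n \ox n)
  }.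

Section Basis.
Variables (k : fieldType) (H : hopfAlgType k).

Lemma basis_ext (B : ydData H) nu n alpha y c d (W : lmodType k) (f g : B -> W) :
  @has_yd_basis k H B nu n alpha y c d ->
  linear f -> linear g -> f 1 = g 1 -> f n = g n -> f =1 g.
Proof.
move=> S fl gl f1 fn b.
by rewrite (basis_dec S b) !(linD fl) !(linD gl) !(linZ fl) !(linZ gl) f1 fn.
Qed.

(** The parameters determine the structure: match the two bases. *)
Lemma basis_iso (B C : ydData H) nu n nu' n' alpha y c d :
  @has_yd_basis k H B nu n alpha y c d -> @has_yd_basis k H C nu' n' alpha y c d ->
  yd_isomorphic B C.
Proof.
move=> SB SC.
have [nul nu1 nun _ el e1 en sq al a1 an cl c1 cn dl d1 dn] := SB.
have [nul' nu1' nun' _ el' e1' en' sq' al' a1' an' cl' c1' cn' dl' d1' dn'] := SC.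
pose phi (b : B) : C := (yd_counit b : k) *: 1 + (nu b : k) *: n'.
pose psi (b : C) : B := (yd_counit b : k) *: 1 + (nu' b : k) *: n.
have pl : linear phi by rewrite /phi; lin.
have ql : linear psi by rewrite /psi; lin.
have p1 : phi 1 = 1 by rewrite /phi e1 nu1 scale1r scale0r addr0.
have pn : phi n = n' by rewrite /phi en nun scale1r scale0r add0r.
have q1 : psi 1 = 1 by rewrite /psi e1' nu1' scale1r scale0r addr0.
have qn : psi n' = n by rewrite /psi en' nun' scale1r scale0r add0r.
have pM : monoid_morphism phi.
  split=> // x z; move: x; apply: (basis_ext SB); [lin|lin| |].
    by rewrite p1 !mul1r.
  move: z; apply: (basis_ext SB); [lin|lin| |]; first by rewrite p1 !mulr1.
  by rewrite sq (linZ pl) !pn.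
pose phi' : {lrmorphism B -> C} := HB.pack phi
  (GRing.isLinear.Build k B C *:%R phi pl)
  (GRing.isMonoidMorphism.Build B C phi pM).
have phiE b : phi' b = phi b by [].
exists phi'; split.
- exists psi; rewrite /=.
    by apply: (basis_ext SB); rewrite /= ?p1 ?pn //; lin.
  by apply: (basis_ext SC); rewrite /= ?q1 ?qn //; lin.
- move=> h; apply: (basis_ext SB); rewrite /= ?phiE; [lin|lin| |].
    by rewrite a1 (linZ pl) p1 a1'.
  by rewrite an (linZ pl) pn an'.
- apply: (basis_ext SB); rewrite /= ?phiE; [lin|lin| |].
    by rewrite p1 c1 c1' tlift_pure ?p1 //; lin.
  by rewrite pn cn cn' tlift_pure ?pn //; lin.
- apply: (basis_ext SB); rewrite /= ?phiE; [lin|lin| |].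
    by rewrite p1 d1 d1' tlift_pure ?p1 //; lin.
  have bl : bilin (fun b1 b2 : B => phi b1 \ox phi b2) by lin.
  by rewrite pn dn dn' !tliftD // tliftZ // !tlift_pure // p1 pn.
- apply: (basis_ext SB); rewrite /= ?phiE; [lin|lin| |].
    by rewrite p1 e1 e1'.
  by rewrite pn en en'.
Qed.
End Basis.

(** * The case c = d = 0 *)

Section PrimitiveGenerator.
Variables (k : fieldType) (H : hopfAlgType k).
Variables (B : ydData H) (nu : B -> k^o) (n : B).
Variables (alpha : {lrmorphism H -> k^o}) (y : H).
Hypothesis SB : has_yd_basis nu n alpha y 0 0.
Hypothesis ypair : yd_pair alpha y.

Local Notation act := (@yd_act k H B).
Local Notation coact := (@yd_coact k H B).
Local Notation delta := (@yd_comul k H B).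
Local Notation eps := (@yd_counit k H B).

Lemma act_linear_left m : linear (act^~ m).
Proof.
have [nul nu1 nun bd el e1 en sq al a1 an cl c1 cn dl d1 dn] := SB.
have alphal : linear alpha := linearP alpha.
pose f h : B := (eps m : k) *: ((counit h : k) *: 1)
  + (nu m : k) *: ((alpha h : k) *: n).
have fE h : act h m = f h.
  by rewrite {1}(bd m) (linD (al h)) !(linZ (al h)) a1 an.
by move=> a u v; rewrite !fE; move: a u v; rewrite -/(linear f) /f; lin.
Qed.

Lemma basis_module : is_left_module act.
Proof.
have [nul nu1 nun bd el e1 en sq al a1 an cl c1 cn dl d1 dn] := SB.
split=> //; first exact: act_linear_left.
  apply: (basis_ext SB); [lin | lin | |].
    by rewrite a1 counit1 scale1r.
  by rewrite an rmorph1 scale1r.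
move=> g h; apply: (basis_ext SB); [lin | lin | |].
  by rewrite !a1 (linZ (al g)) a1 scalerA counitM mulrC.
by rewrite !an (linZ (al g)) an scalerA rmorphM mulrC.
Qed.

Lemma basis_comodule : is_left_comodule coact.
Proof.
have [nul nu1 nun bd el e1 en sq al a1 an cl c1 cn dl d1 dn] := SB.
have [[gy ey] ay E] := ypair.
split=> //.
  apply: (basis_ext SB); [lin | lin | |].
    by rewrite c1; sweval; rewrite comul1 c1; sweval.
  by rewrite cn; sweval; rewrite gy cn; sweval.
apply: (basis_ext SB); [lin | lin | |].
  by rewrite c1; sweval; rewrite counit1 scale1r.
by rewrite cn; sweval; rewrite ey scale1r.
Qed.

Lemma basis_yd : is_yd_module act coact.
Proof.
have [nul nu1 nun bd el e1 en sq al a1 an cl c1 cn dl d1 dn] := SB.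
have [gy ay E] := ypair.
have alphal : linear alpha := linearP alpha.
have actl := act_linear_left.
split; [exact: basis_module|exact: basis_comodule|].
move=> h; apply: (basis_ext SB); [lin | lin | |].
  (* At 1 both sides are h (x) 1. *)
  transitivity (h \ox (1 : B)).
    rewrite -(sw_counitr h (linear_tprodl (1 : B))).
    by apply: eq_tlift => h1 h2; rewrite c1; sweval; rewrite mulr1 a1 tprodZr.
  rewrite -(sw_counitl h (linear_tprodl (1 : B))).
  apply: eq_tlift => h1 h2; rewrite a1 (linZ cl) c1; sweval.
  by rewrite mul1r.
(* At n both sides are explicit, and equal by the condition on the pair. *)
have EE := (yd_pairE alpha gy).1 E h.
transitivity ((lhit alpha h * y) \ox n).
  rewrite /lhit -[X in _ = X]/((fun x => (x * y) \ox n) _).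
  rewrite lin_tlift; last by lin.
  apply: eq_tlift => h1 h2; rewrite cn; sweval.
  by rewrite an tprodZr -scalerAl tprodZl.
rewrite EE /rhit -[X in X = _]/((fun x => (y * x) \ox n) _).
rewrite lin_tlift; last by lin.
apply: eq_tlift => h1 h2; rewrite an (linZ cl) cn; sweval.
by rewrite -scalerAr tprodZl.
Qed.

Lemma basis_coalgebra : is_coalgebra delta eps.
Proof.
have [nul nu1 nun bd el e1 en sq al a1 an cl c1 cn dl d1 dn] := SB.
have dn' : delta n = n \ox 1 + 1 \ox n.
  by rewrite dn scale0r addr0.
split=> //.
- apply: (basis_ext SB); [lin | lin | |].
    by rewrite d1; sweval; rewrite d1; sweval.
  rewrite dn'; sweval; rewrite d1 dn'; sweval.
  by rewrite tprodDr addrA.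
- apply: (basis_ext SB); [lin | lin | |].
    by rewrite d1; sweval; rewrite e1 scale1r.
  by rewrite dn'; sweval; rewrite e1 en scale1r scale0r add0r.
apply: (basis_ext SB); [lin | lin | |].
  by rewrite d1; sweval; rewrite e1 scale1r.
by rewrite dn'; sweval; rewrite e1 en scale1r scale0r addr0.
Qed.

(** Both sides of each axiom are linear, or bilinear, so that they are compared on
    1 and n only. *)
Lemma basis_bialgebra : is_yd_bialgebra B.
Proof.
have [nul nu1 nun bd el e1 en sq al a1 an cl c1 cn dl d1 dn] := SB.
have [[gy ey] ay E] := ypair.
have alphal : linear alpha := linearP alpha.
have actl := act_linear_left.
have dn' : delta n = n \ox 1 + 1 \ox n by rewrite dn scale0r addr0.
have nn : n * n = 0 by rewrite sq scale0r.
split=> //.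
- exact: basis_yd.
- exact: basis_coalgebra.
- move=> h b c; move: b; apply: (basis_ext SB); [lin|lin| |].
    rewrite mul1r -(sw_counitl h (actl c)); apply: eq_tlift => h1 h2.
    by rewrite a1 -scalerAl mul1r.
  move: c; apply: (basis_ext SB); [lin|lin| |].
    rewrite mulr1 -(sw_counitr h (actl n)); apply: eq_tlift => h1 h2.
    by rewrite a1 -scalerAr mulr1.
  rewrite nn (lin0 (al h)) -[LHS](tlift_zero _ (comul h)).
  apply: eq_tlift => h1 h2.
  by rewrite !an -scalerAl -scalerAr nn !scaler0.
- move=> b c; move: b; apply: (basis_ext SB); [lin|lin| |].
    move: c; apply: (basis_ext SB); [lin|lin| |].
      by rewrite mulr1 c1; sweval; rewrite ?c1; sweval; rewrite !mul1r.
    by rewrite mul1r c1; sweval; rewrite ?cn; sweval; rewrite !mul1r.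
  move: c; apply: (basis_ext SB); [lin|lin| |].
    by rewrite mulr1 cn; sweval; rewrite ?c1; sweval; rewrite !mulr1.
  by rewrite nn cn; sweval; rewrite ?cn; sweval; rewrite nn tprod0r (lin0 cl).
- move=> h; apply: (basis_ext SB); [lin|lin| |].
    by rewrite a1 (linZ el).
  by rewrite an (linZ el) en mulr0 scaler0.
- move=> h; apply: (basis_ext SB); [lin|lin| |].
    rewrite a1 (linZ dl) d1; under eq_tlift => h1 h2.
      sweval. rewrite !a1 tprodZl tprodZr. over.
    by rewrite (sw_counitl h (linear_scalef _ (@counit_linear _ H))).
  rewrite an (linZ dl) dn'; under eq_tlift => h1 h2.
    sweval; rewrite !a1 !an !tprodZl !tprodZr.
    rewrite [X in X + _]scalerA mulrC -scalerA; over.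
  rewrite tlift_add (sw_counitl h (linear_scalef _ alphal)).
  by rewrite (sw_counitr h (linear_scalef _ alphal)) scalerDr.
- apply: (basis_ext SB); [lin|lin| |].
    by rewrite c1; sweval; rewrite e1.
  by rewrite cn; sweval; rewrite en !scale0r.
- apply: (basis_ext SB); [lin|lin| |].
    rewrite c1 d1; sweval; rewrite ?d1 ?c1; sweval; rewrite ?c1; sweval.
    by rewrite mul1r.
  rewrite cn dn'; sweval; rewrite ?dn' ?c1 ?cn; sweval; rewrite ?c1 ?cn; sweval.
  by rewrite tprodDr mul1r mulr1.
- move=> b c; move: b; apply: (basis_ext SB); [lin|lin| |].
    by rewrite mul1r e1 mul1r.
  move: c; apply: (basis_ext SB); [lin|lin| |].
    by rewrite mulr1 en mul0r.
  by rewrite nn (lin0 el) en mul0r.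
move=> b c; move: b; apply: (basis_ext SB); [lin|lin| |].
  move: c; apply: (basis_ext SB); [lin|lin| |].
    rewrite mulr1 d1; sweval; rewrite ?c1; sweval; rewrite ?d1; sweval.
    by rewrite a1 counit1 scale1r !mul1r.
  rewrite mul1r d1; sweval; rewrite ?c1; sweval; rewrite ?dn'; sweval.
  by rewrite a1 an counit1 rmorph1 !scale1r !mul1r.
move: c; apply: (basis_ext SB); [lin|lin| |].
  rewrite mulr1 dn'; sweval; rewrite ?c1 ?cn; sweval; rewrite ?d1; sweval.
  by rewrite !a1 counit1 ey !scale1r !mul1r !mulr1.
(* Delta(n) Delta(n) is the sum of n (x) n and of (y . n) (x) n = alpha(y) n (x) n,
   and so it vanishes. *)
rewrite nn (lin0 dl) dn'; sweval; rewrite ?c1 ?cn; sweval; rewrite ?dn'; sweval.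
rewrite !a1 !an counit1 ey ay !rmorph1 !scale1r !mul1r !mulr1 nn tprod0l tprod0r.
by rewrite scaleN1r -scaleN1r tprodZl scaleN1r add0r addr0 subrr.
Qed.

Definition basis_antipode (b : B) : B := (eps b : k) *: 1 - (nu b : k) *: n.

Lemma basis_antipodeP : is_yd_antipode basis_antipode.
Proof.
have [nul nu1 nun bd el e1 en sq al a1 an cl c1 cn dl d1 dn] := SB.
have dn' : delta n = n \ox 1 + 1 \ox n by rewrite dn scale0r addr0.
have Sl : linear basis_antipode by rewrite /basis_antipode; lin.
have S1 : basis_antipode 1 = 1.
  by rewrite /basis_antipode e1 nu1 scale1r scale0r subr0.
have Sn : basis_antipode n = - n.
  by rewrite /basis_antipode en nun scale1r scale0r sub0r.
split=> //.
- move=> h; apply: (basis_ext SB); [lin|lin| |].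
    by rewrite S1 a1 (linZ Sl) S1.
  by rewrite Sn an (linZ Sl) Sn -scaleN1r (linZ (al h)) an !scaleN1r scalerN.
- apply: (basis_ext SB); [lin|lin| |].
    by rewrite S1 c1; sweval; rewrite S1.
  rewrite Sn -scaleN1r (linZ cl) cn; sweval; rewrite Sn.
  by rewrite -[- n]scaleN1r tprodZr.
- apply: (basis_ext SB); [lin|lin| |].
    by rewrite d1; sweval; rewrite S1 mul1r e1 scale1r.
  by rewrite dn'; sweval; rewrite S1 Sn mul1r mulr1 en scale0r addNr.
apply: (basis_ext SB); [lin|lin| |].
  by rewrite d1; sweval; rewrite S1 mul1r e1 scale1r.
by rewrite dn'; sweval; rewrite S1 Sn mul1r mulr1 en scale0r addrN.
Qed.
End PrimitiveGenerator.

(** * The two families of examples *)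

Section Examples.
Variables (k : fieldType) (H : hopfAlgType k).

Lemma Balpha_y_basis (alpha : H -> k^o) (y : H) :
  has_yd_basis (B := Balpha_y alpha y) (@dn_snd k) (dn_n k) alpha y 0 0.
Proof.
have f1 : linear (@dn_fst k : dual_number k -> k^o) by [].
have f2 : linear (@dn_snd k : dual_number k -> k^o) by [].
split=> //=.
- exact: dn_basis.
- by rewrite dn_nn scale0r.
- by move=> h a u v; congr DualNumber => /=; rewrite mulrDr mulrCA.
- by move=> h; congr DualNumber; rewrite /= ?mulr0.
- by move=> h; congr DualNumber; rewrite /= ?mulr0.
- lin.
- by rewrite scale1r scale0r addr0.
- by rewrite scale1r scale0r add0r.
- lin.
- by rewrite scale1r scale0r addr0.
- by rewrite !scale0r scale1r add0r addr0.
Qed.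

Lemma sqr_involution_sub1 (A : algType k) (g : A) :
  g * g = 1 -> (g - 1) * (g - 1) = (- 2%:R : k) *: (g - 1).
Proof.
move=> gg; rewrite mulrBl mulrBr gg mulr1 mul1r -[1 - g]opprB -opprD.
by rewrite scaleNr scaler_nat mulr2n.
Qed.

Lemma sum_Z2 (V : nmodType) (F : 'Z_2 -> V) : \sum_g F g = F 0 + F 1.
Proof.
rewrite big_ord_recl big_ord1; congr (_ + F _); exact: val_inj.
Qed.

(** If g is the generator of Z/2, then n = (g - 1) / d spans the augmentation
    ideal, and g = 1 + d n is grouplike. The relation (g - 1)^2 = -2 (g - 1) gives
    n n = (-2 / d) n. The free parameter d is the choice of the scale of n. *)
Lemma Z2_group_algebra_basis (alpha : H -> k^o) (c d : k) :
  alpha =1 counit -> d != 0 -> c * d = - 2%:R ->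
  has_yd_basis (B := trivial_group_algebra 'Z_2 H)
    (fun f : group_algebra k 'Z_2 => f 1 * d) (d^-1 *: (ga_of k 1 - 1))
    alpha 1 c d.
Proof.
move=> aE d0 cd; set g := ga_of k (1 : 'Z_2); set n := d^-1 *: (g - 1).
have oneE : 1 = ga_of k (0 : 'Z_2) by [].
have gD x : linear (fun f : group_algebra k 'Z_2 => f x : k^o).
  by move=> a u v; rewrite /= !ffunE.
have o0 : (1 : group_algebra k 'Z_2) 0 = 1 by rewrite ffunE.
have o1 : (1 : group_algebra k 'Z_2) 1 = 0 by rewrite ffunE.
have n0 : n 0 = - d^-1 by rewrite !ffunE /= sub0r mulrN1.
have n1 : n 1 = d^-1 by rewrite !ffunE /= subr0 mulr1.
have gg : g * g = 1 by rewrite /g ga_ofD oneE; congr ga_of; apply: val_inj.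
have gE : g = 1 + d *: n by rewrite /n scalerA mulfV // scale1r addrC subrK.
have nn : n * n = c *: n.
  have gg1 : (g - 1) * (g - 1) = (- 2%:R) *: (g - 1).
    exact: sqr_involution_sub1.
  have -> : c = - 2%:R / d by rewrite -cd mulfK.
  rewrite /n -scalerAl -scalerAr gg1 !scalerA; congr (_ *: _).
  by rewrite mulrC mulrA.
clearbody n.
(* From here on g, and not n, is the derived element: g = 1 + d n. *)
have gn : g \ox g = 1 \ox 1 + d *: (n \ox 1 + 1 \ox n + d *: (n \ox n)).
  rewrite gE tprodDl !tprodDr !tprodZl !tprodZr !scalerDr !scalerA.
  by rewrite [X in _ = _ + (X + _)]addrC !addrA.
pose B := trivial_group_algebra 'Z_2 H.
have epsE (f : B) : yd_counit f = f 0 + f 1 :> k by rewrite -sum_Z2.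
have delE (f : B) :
    yd_comul f = f 0 *: (1 \ox 1 : {tensor B & B}) + f 1 *: (g \ox g).
  by rewrite -[LHS]/(\sum_x f x *: _) sum_Z2.
split.
- by move=> a u v; rewrite (gD 1) mulrDl scalerAl.
- by rewrite o1 mul0r.
- by rewrite n1 mulVf.
- move=> b; apply/ga_eqP => x; rewrite epsE.
  (* The sum of b_0 1 and b_1 g. *)
  have -> : (b 0 + b 1)%:A + (b 1 * d) *: n = b 0 *: 1 + b 1 *: (1 + d *: n).
    by rewrite scalerDl scalerDr scalerA addrA.
  rewrite -gE !ffunE; case: x => [[|[|//]] px] /=.
    by rewrite mulr1 mulr0 addr0; congr (b _); apply: val_inj.
  by rewrite mulr1 mulr0 add0r; congr (b _); apply: val_inj.
- by move=> a u v; rewrite !epsE (gD 0) (gD 1) scalerDr addrACA.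
- by rewrite epsE o0 o1 addr0.
- by rewrite epsE n0 n1 addNr.
- exact: nn.
- by move=> h; apply: linear_scaler.
- by [].
- by move=> h; rewrite aE.
- by move=> a u v; rewrite -[LHS]/(_ \ox _) tprodDr tprodZr.
- by [].
- by [].
- move=> a u v; rewrite !delE (gD 0) (gD 1) !scalerDl scalerDr addrACA.
  by rewrite !scalerA.
- by rewrite delE o0 o1 scale1r scale0r addr0.
rewrite delE n0 n1 gn scalerDr scalerA mulVf // scale1r addrA -scalerDl.
by rewrite addNr scale0r add0r.
Qed.
End Examples.

(** * Extracting the parameters *)

(** The functional nu is the determinant against 1: if (u, w) and (b_0, b_1) are
    the coordinates of 1 and b, then nu b = w b_0 - u b_1, which vanishes at 1.
    In the same basis n is (q, -p), where (p, q) are the values of the counit;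
    since u p + w q = 1, no case distinction is needed. *)
Lemma two_dim_split (k : fieldType) (A : algType k) (eps : A -> k^o) :
  linear eps -> eps 1 = 1 -> Vector.axiom 2 A ->
  exists (nu : A -> k^o) (n : A), [/\ linear nu, nu 1 = 0, nu n = 1, eps n = 0 &
    forall b, b = (eps b : k) *: 1 + (nu b : k) *: n].
Proof.
move=> el e1 [r rl [v rK vK]].
have vl : linear v by move=> a x z; apply: (can_inj rK); rewrite rl !vK.
pose b0 := v (delta_mx 0 0); pose b1 := v (delta_mx 0 1).
have dec b : b = r b 0 0 *: b0 + r b 0 1 *: b1.
  rewrite -[LHS]rK {1}[r b]row_sum_delta !big_ord_recl big_ord0 addr0.
  have -> : lift ord0 ord0 = 1 :> 'I_2 by exact: val_inj.
  by rewrite (linD vl) !(linZ vl).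
pose p : k := eps b0; pose q : k := eps b1.
pose u := r 1 0 0; pose w := r 1 0 1.
have pq : u * p + w * q = 1.
  by have := e1; rewrite (dec 1) (linD el) !(linZ el).
have r0 a x z : r (a *: x + z) 0 0 = a * r x 0 0 + r z 0 0 by rewrite rl !mxE.
have r1 a x z : r (a *: x + z) 0 1 = a * r x 0 1 + r z 0 1 by rewrite rl !mxE.
pose n := q *: b0 - p *: b1.
have n0 : r n 0 0 = q.
  rewrite /n -scaleNr addrC r0 /b0 /b1 -[q *: _]addr0 r0 !vK (lin0 rl).
  by rewrite !mxE /=; ring.
have n1 : r n 0 1 = - p.
  rewrite /n -scaleNr addrC r1 /b0 /b1 -[q *: _]addr0 r1 !vK (lin0 rl).
  by rewrite !mxE /=; ring.
have epsE b : eps b = r b 0 0 * p + r b 0 1 * q :> k.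
  by rewrite {1}(dec b) (linD el) !(linZ el).
exists (fun b => w * r b 0 0 - u * r b 0 1), n; split.
- by move=> a x z; rewrite r0 r1 /GRing.scale /=; ring.
- by rewrite -/u -/w; ring.
- by rewrite n0 n1 -pq; ring.
- by rewrite epsE n0 n1; ring.
move=> b; apply: (can_inj rK); apply/rowP => i.
have rD x z j : r (x + z) 0 j = r x 0 j + r z 0 j by rewrite (linD rl) mxE.
have rZ a x j : r (a *: x) 0 j = a * r x 0 j by rewrite (linZ rl) mxE.
rewrite rD !rZ epsE.
have [->|->] : i = 0 \/ i = 1.
- by case: i => [[|[|//]] ?]; [left|right]; apply: val_inj.
- rewrite n0 -/u; transitivity (r b 0 0 * (u * p + w * q)); last by ring.
  by rewrite pq mulr1.
rewrite n1 -/w; transitivity (r b 0 1 * (u * p + w * q)); last by ring.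
by rewrite pq mulr1.
Qed.

(** A tensor is determined by its coordinates on a basis of the right factor. *)
Lemma tensor_basis_dec (k : fieldType) (U V : lmodType k) (e n : V)
    (eps nu : V -> k^o) (x : {tensor U & V}) :
  linear eps -> linear nu -> (forall b, b = (eps b : k) *: e + (nu b : k) *: n) ->
  x = tlift (fun a b => (eps b : k) *: a) x \ox e +
      tlift (fun a b => (nu b : k) *: a) x \ox n.
Proof.
move=> el nul bd.
pose f (x : {tensor U & V}) := tlift (fun a b => (eps b : k) *: a) x \ox e +
      tlift (fun a b => (nu b : k) *: a) x \ox n.
rewrite -/(f x); move: x; apply: linear_tensor_ext; [lin|rewrite /f; lin|].
move=> u v; rewrite /f; sweval; rewrite {1}(bd v) tprodDr !tprodZr.
by rewrite !tprodZl.
Qed.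

Lemma alg_map_lrmorphism (k : fieldType) (A : algType k) (f : A -> k^o) :
  linear f -> monoid_morphism f -> exists phi : {lrmorphism A -> k^o}, phi =1 f.
Proof.
move=> fl fM.
pose phi : {lrmorphism A -> k^o} := HB.pack f
  (GRing.isLinear.Build k A k^o *:%R f fl)
  (GRing.isMonoidMorphism.Build A k^o f fM).
by exists phi.
Qed.

Section Classification.
Variables (k : fieldType) (H : hopfAlgType k) (B : ydData H).

Local Notation act := (@yd_act k H B).
Local Notation coact := (@yd_coact k H B).
Local Notation delta := (@yd_comul k H B).
Local Notation eps := (@yd_counit k H B).

(** The counit being a morphism and an algebra map, H . n, n n and the coaction on
    n stay in the line of n, so that each gives one parameter; the counit axioms
    fix all coordinates of Delta(n) but the one on n (x) n. That alpha is an
    algebra map is associativity of the action, and that y is grouplike is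
    coassociativity of the coaction, both at n. *)
Lemma yd_bialgebra_basis : is_yd_bialgebra B -> Vector.axiom 2 B ->
  exists (alpha : {lrmorphism H -> k^o}) nu n y c d,
    has_yd_basis (B := B) nu n alpha y c d /\ grouplike y.
Proof.
case=> [[[actl al act1' actM] [cl ca cc] yd]] [dl el co col cor].
move=> a1 aM c1 cM ea da ec dc e1 eM d1 dM.
move=> /(two_dim_split el e1) [nu [n [nul nu1 nun en bd]]].
pose alpha0 h : k^o := nu (act h n).
have an h : act h n = (alpha0 h : k) *: n.
  by rewrite {1}(bd (act h n)) ea en mulr0 scale0r add0r.
have alphal : linear alpha0 by rewrite /alpha0; lin.
have alphaM : monoid_morphism alpha0.
  split; first by rewrite /alpha0 act1' nun.
  move=> g h; rewrite /alpha0 actM {1}(an h) (linZ (al g)) (linZ nul) /alpha0.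
  exact: mulrC.
have [alpha alphaE] := alg_map_lrmorphism alphal alphaM.
pose y := tlift (fun a b => (nu b : k) *: a) (coact n).
have cn : coact n = y \ox n.
  rewrite {1}(tensor_basis_dec (coact n) el nul bd) ec en scale0r tprod0l add0r //.
have sq : n * n = (nu (n * n) : k) *: n.
  by rewrite {1}(bd (n * n)) eM en mul0r scale0r add0r.
(* The coefficient x of Delta(n) = n (x) 1 + x (x) n has counit 1. *)
pose x := tlift (fun a b => (nu b : k) *: a) (delta n).
have xE : x = 1 + (nu x : k) *: n.
  have ex : eps x = 1.
    rewrite -nun -[in RHS](col n) (lin_tlift _ _ nul) /x (lin_tlift _ _ el).
    apply: eq_tlift => a b; rewrite (linZ el) (linZ nul); exact: mulrC.
  by rewrite {1}(bd x) ex scale1r.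
have dn : delta n = n \ox 1 + 1 \ox n + (nu x : k) *: (n \ox n).
  rewrite {1}(tensor_basis_dec (delta n) el nul bd) cor -/x {1}xE tprodDl tprodZl.
  by rewrite addrA.
exists alpha, nu, n, y, (nu (n * n)), (nu x); split.
  by split=> // h; rewrite alphaE.
have := ca n; rewrite cn; sweval; rewrite cn => E.
split.
  (* Strip n from Delta(y) (x) n = y (x) (y (x) n). *)
  pose Q := tlift (fun a z => a \ox tlift (fun b c => (nu c : k) *: b) z)
    : {tensor H & {tensor H & B}} -> {tensor H & H}.
  have Ql : linear Q by rewrite /Q; lin.
  have := congr1 Q E; rewrite (lin_tlift _ _ Ql) /Q; sweval.
  rewrite nun scale1r => <-.
  rewrite {1}(tensor_sum (comul y)); apply: eq_tlift => a b; sweval.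
  by rewrite nun scale1r.
have := congr1 nu (cc n); rewrite cn; sweval.
by rewrite (linZ nul) nun [_ *: _]mulr1.
Qed.

End Classification.

(** * Constraints on the parameters *)

Section Constraints.
Variables (k : fieldType) (H : hopfAlgType k) (B : ydData H).
Variables (nu : B -> k^o) (n : B).
Variables (alpha : {lrmorphism H -> k^o}) (y : H) (c d : k).
Hypothesis SB : has_yd_basis nu n alpha y c d.
Hypothesis bialgB : is_yd_bialgebra B.
Hypothesis gy : grouplike y.

Local Notation act := (@yd_act k H B).
Local Notation coact := (@yd_coact k H B).
Local Notation delta := (@yd_comul k H B).
Local Notation eps := (@yd_counit k H B).

(** The Yetter-Drinfel'd condition at n, with n stripped from both sides. *)
Lemma basis_compat h : lhit alpha h * y = y * rhit h alpha.
Proof.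
have [nul nu1 nun bd el e1 en sq al a1 an cl c1 cn dl d1 dn] := SB.
have actl := act_linearl (yd_module (ydb_module bialgB)).
pose Q : {tensor H & B} -> H := tlift (fun a b => (nu b : k) *: a).
have Ql : linear Q by rewrite /Q; lin.
have := congr1 Q (yd_compat (ydb_module bialgB) h n).
rewrite !(lin_tlift _ _ Ql) => E.
rewrite /lhit /rhit -[LHS]/((fun x => x * y) _) lin_tlift; last by lin.
rewrite -[RHS]/((fun x => y * x) _) lin_tlift; last by lin.
etransitivity; [|etransitivity; [exact: E|]]; apply: eq_tlift => h1 h2.
  rewrite cn; sweval; rewrite /Q; sweval.
  by rewrite an (linZ nul) nun [_ *: 1]mulr1 scalerAl.
rewrite an (linZ cl) cn; sweval; rewrite (linZ Ql) /Q; sweval.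
by rewrite nun scale1r scalerAr.
Qed.

(** Comparing h . (n n) = c alpha(h) n with (h_1 . n)(h_2 . n) shows that alpha is
    idempotent for convolution. *)
Lemma basis_char_mul : c != 0 -> alpha =1 @counit k H.
Proof.
have [nul nu1 nun bd el e1 en sq al a1 an cl c1 cn dl d1 dn] := SB.
move=> c0; apply: idempotent_alg_map => h; apply: (scalerI c0).
have -> : c *: alpha h = nu (act h (n * n)).
  by rewrite sq (linZ (al h)) an !(linZ nul) nun [alpha h *: 1]mulr1.
rewrite (ydb_actM bialgB) (lin_tlift _ _ nul) /conv.
rewrite (lin_tlift _ _ (linear_scaler c)).
apply: eq_tlift => h1 h2.
rewrite !an -scalerAl -scalerAr sq !(linZ nul) nun /GRing.scale /=; ring.
Qed.

(** The coefficient of n (x) n in Delta(h . n) is d alpha(h) on one side and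
    d (alpha * alpha)(h) on the other. *)
Lemma basis_char_comul : d != 0 -> alpha =1 @counit k H.
Proof.
have [nul nu1 nun bd el e1 en sq al a1 an cl c1 cn dl d1 dn] := SB.
move=> d0; apply: idempotent_alg_map => h; apply: (scalerI d0).
pose mu : {tensor B & B} -> k^o := tlift (fun a b => nu a * nu b).
have mul : linear mu by rewrite /mu; lin.
have muE u v : mu (u \ox v) = nu u * nu v by rewrite /mu; sweval.
have -> : d *: alpha h = mu (delta (act h n)).
  rewrite an (linZ dl) dn (linZ mul) !(linD mul) (linZ mul) !muE nun nu1.
  by rewrite /GRing.scale /=; ring.
rewrite (ydb_comul_act bialgB) dn (lin_tlift _ _ mul) /conv.
rewrite (lin_tlift _ _ (linear_scaler d)).
apply: eq_tlift => h1 h2; sweval.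
rewrite !a1 !an !(linD mul) (linZ mul) !muE !(linZ nul) nun nu1 /GRing.scale /=.
ring.
Qed.

(** The coaction of n n = c n is c y (x) n on one side and c y^2 (x) n on the
    other, and y is invertible. *)
Lemma basis_grouplike1 : c != 0 -> y = 1.
Proof.
have [nul nu1 nun bd el e1 en sq al a1 an cl c1 cn dl d1 dn] := SB.
move=> c0; pose Q : {tensor H & B} -> H := tlift (fun a b => (nu b : k) *: a).
have Ql : linear Q by rewrite /Q; lin.
have := congr1 Q (ydb_coactM bialgB n n).
rewrite sq (linZ cl) cn (linZ Ql); sweval; rewrite /Q; sweval.
rewrite sq (linZ nul) nun scale1r [c *: 1]mulr1 => /(scalerI c0) yy.
by have := congr1 ( *%R (grouplike_inv y)) yy; rewrite mulrA grouplike_invl ?mul1r.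
Qed.

(** The coefficient of n (x) n in Delta(n n) = Delta(n) Delta(n). *)
Lemma basis_comulM_eq :
  c * d = 1 + alpha y + 2%:R * (c * d) + 2%:R * (c * d) * alpha y
          + (c * d) ^+ 2 * alpha y.
Proof.
have [nul nu1 nun bd el e1 en sq al a1 an cl c1 cn dl d1 dn] := SB.
have actl := act_linearl (yd_module (ydb_module bialgB)).
have act1' := act1 (yd_module (ydb_module bialgB)).
pose mu : {tensor B & B} -> k^o := tlift (fun a b => nu a * nu b).
have mul : linear mu by rewrite /mu; lin.
have muE u v : mu (u \ox v) = nu u * nu v by rewrite /mu; sweval.
have := congr1 mu (ydb_comulM bialgB n n).
rewrite sq (linZ dl) dn; sweval; rewrite ?c1 ?cn; sweval; rewrite ?dn; sweval.
rewrite !act1' !an a1 (proj2 gy) scale1r !mulr1 !mul1r -!scalerAr !sq.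
rewrite !(linD mul, linZ mul, muE, linZ nul) nun nu1 /GRing.scale /= => E.
move: E; rewrite !(mulr0, mul0r, mulr1, mul1r, addr0, add0r) => E.
pose a : k := alpha y; rewrite -/a.
have {}E : c * d = 1 + d * c + (a + d * (a * c))
    + d * (a * c + c + d * (a * c * c)) := E.
by rewrite {1}E; ring.
Qed.

(** The antipode axiom at n yields first eps (S n) = 0, so that S n = s n, and then
    s + 1 + c d s = 0, which is absurd when c d = -1. *)
Lemma basis_antipode_neq (S : B -> B) : is_yd_antipode S -> c * d != - 1.
Proof.
have [nul nu1 nun bd el e1 en sq al a1 an cl c1 cn dl d1 dn] := SB.
case=> Sl _ _ Sleft _; apply/eqP => cd.
have S1 : S 1 = 1.
  by have := Sleft 1; rewrite d1; sweval; rewrite mulr1 e1 scale1r.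
have := Sleft n; rewrite dn; sweval.
rewrite S1 mul1r mulr1 en scale0r => E.
have eM := ydb_counitM bialgB.
have eS : eps (S n) = 0.
  have := congr1 eps E.
  by rewrite !(linD el) (linZ el) eM en mulr0 scaler0 (lin0 el) !addr0.
move: E; rewrite (bd (S n)) eS scale0r add0r -scalerAl sq.
move/(congr1 nu); rewrite !(linD nul) !(linZ nul) nun (lin0 nul) => E.
have : nu (S n) + 1 + (c * d) * nu (S n) = 0 :> k.
  rewrite -[RHS]E /GRing.scale /=; ring.
by rewrite cd mulN1r addrAC subrr add0r => /eqP; rewrite oner_eq0.
Qed.
End Constraints.

Theorem theorem1 (k : fieldType) (H : hopfAlgType k)
    (chark : 2%N \notin [pchar k]) :
  (forall (alpha : {lrmorphism H -> k^o}) (y : H),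
      yd_pair alpha y -> is_yd_hopf (Balpha_y alpha y)) /\
  (forall B : ydData H, is_yd_hopf B -> Vector.axiom 2 B ->
      yd_isomorphic B (trivial_group_algebra 'Z_2 H) \/
      exists (alpha : {lrmorphism H -> k^o}) (y : H),
        yd_pair alpha y /\ yd_isomorphic B (Balpha_y alpha y)).
Proof.
split=> [alpha y ypair | B [bialgB [S antiS]] dimB].
  have SB := Balpha_y_basis alpha y.
  split; first exact: basis_bialgebra SB ypair.
  by eexists; apply: (basis_antipodeP SB).
have two0 : 2%:R != 0 :> k by move: chark; rewrite inE.
have [alpha [nu [n [y [c [d [SB gy]]]]]]] := yd_bialgebra_basis bialgB dimB.
have E := basis_comulM_eq SB bialgB gy.
have [c0|c0] := eqVneq c 0; last first.
  (* alpha = epsilon, y = 1, and c d = -2. *)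
  have aE := basis_char_mul SB bialgB c0.
  have yE := basis_grouplike1 SB bialgB gy c0.
  have cd1 := basis_antipode_neq SB bialgB antiS.
  have cd : c * d = - 2%:R.
    have : (c * d + 1) * (c * d + 2%:R) = 0.
      have ay : alpha y = 1 :> k by rewrite yE rmorph1.
      move: E; rewrite ay => /esym/eqP; rewrite -subr_eq0 => /eqP <-.
      by ring.
    move/eqP; rewrite mulf_eq0 !addr_eq0 (negPf cd1) /= => /eqP //.
  have d0 : d != 0.
    by apply: contra_neq two0 => d0; apply: oppr_inj; rewrite -cd d0 mulr0 oppr0.
  left; apply: basis_iso SB _.
  by rewrite yE; apply: Z2_group_algebra_basis.
(* Here c = 0, and so alpha(y) = -1 and d = 0. *)
right; exists alpha, y.
have a1 : alpha y = -1.
  move: E; rewrite c0 mul0r mulr0 expr0n /= !mul0r !addr0 => /esym/eqP.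
  by rewrite addrC addr_eq0 => /eqP.
have d0 : d = 0.
  apply/eqP; apply: contraT => d0.
  have := basis_char_comul SB bialgB d0 y.
  rewrite a1 (proj2 gy) => /esym/eqP; rewrite -addr_eq0 -mulr2n => two.
  by move: two0; rewrite two.
split.
  by split=> //; apply/yd_pairE => //; apply: basis_compat SB bialgB.
by subst c d; apply: basis_iso SB (Balpha_y_basis alpha y).
Qed.
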